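(* Let $C$ be a caterpillar whose spine has order $s$, and suppose $C$ has a tail of order $\left\lfloor \frac{s-1}{2}\right\rfloor$. Then $C$ is antimagic.
   Context: All graphs are finite, simple and connected. For a graph $G$ and vertex $v$, $E(v)$ is the set of edges incident to $v$ and $d(v)=|E(v)|$. A graph $G$ is antimagic if there is a bijection $f:E(G)\to\{1,2,\dots,|E(G)|\}$ such that the vertex sums $\sum_{e\in E(v)} f(e)$, $v\in V(G)$, are pairwise distinct. A caterpillar is a tree of order at least $3$ such that removing all its leaves yields a path, called its spine; the order of the spine is its number of vertices. A tail of order $t$ in a caterpillar $C$ is a path in $C$ consisting of one endpoint of a longest path in $C$ together with $t-1$ further vertices, each of degree $2$ in $C$. *)

(* Defs.v *)
From mathcomp Require Import all_boot.

Set Implicit Arguments.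
Unset Strict Implicit.
Unset Printing Implicit Defensive.

(* A finite simple graph is a symmetric irreflexive relation
   e : rel T on a finType T; edges are the two-element sets [set x; y]. *)

Section Graphs.

Variables (T : finType) (e : rel T).

Definition simple_graph : Prop := symmetric e /\ irreflexive e.

Definition edges : {set {set T}} :=
  [set [set xy.1; xy.2] | xy : T * T & e xy.1 xy.2].

Definition incident (v : T) : {set {set T}} := [set E in edges | v \in E].

Definition deg (v : T) : nat := #|incident v|.

Definition antimagic : Prop :=
  exists f : {set T} -> nat,
    [/\ {in edges &, injective f},
        forall k : nat,
          (exists2 E, E \in edges & f E = k) <-> 1 <= k <= #|edges| &
        injective (fun v : T => \sum_(E in incident v) f E)].

Definition connected_graph : Prop :=
  0 < #|T| /\ forall x y : T, connect e x y.

(* For a simple graph, a ucycle of size at most 2 is empty or walks back along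
   a single edge; the cycles of the graph are the ucycles of size at least 3. *)
Definition acyclic : Prop := forall c : seq T, ucycle e c -> size c < 3.

Definition tree : Prop := [/\ simple_graph, connected_graph & acyclic].

(* A path in the graph, as the list of its vertices in order; [::] is allowed. *)
Definition gpath (p : seq T) : bool := sorted e p && uniq p.

(* The subgraph induced by A is a path: no edges besides consecutive ones. *)
Definition induces_path (A : {set T}) : Prop :=
  exists p : seq T,
    [/\ p != [::], uniq p, p =i A &
        {in p &, forall x y,
           e x y = (index y p == (index x p).+1)
                || (index x p == (index y p).+1)}].

Definition spine : {set T} := [set v | deg v != 1].

Definition caterpillar : Prop :=
  [/\ tree, 3 <= #|T| & induces_path spine].

Definition end_of_longest_path (v : T) : Prop :=
  exists (x : T) (p : seq T),
    [/\ gpath (x :: p),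
        forall q : seq T, gpath q -> size q <= size (x :: p) &
        v = x \/ v = last x p].

(* The order of a path is its number of vertices. The tail of order 0 is by
   convention the empty path, which every graph has. *)
Definition has_tail (t : nat) : Prop :=
  exists p : seq T,
    [/\ gpath p, size p = t &
        0 < t ->
        exists2 v, v \in p &
          end_of_longest_path v /\
          (forall u, u \in p -> u != v -> deg u = 2)].

End Graphs.

(* Main.v *)
Require Import Defs.
From mathcomp Require Import all_boot.
From mathcomp Require Import zify.

(* Let w_1, ..., w_s be the spine, starting at the end with the tail, and extend
   it by leaves w_0 and w_{s+1} to a longest path; let R be the set of the other
   leaves, k = s./2 + 1 and L = k + |R|.  Label the edges w_i w_{i+1} of the path,
   0 <= i <= s, alternately with small labels 1, ..., k and large labels
   L + 1, L + 2, ..., both increasing along the path and such that the last one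
   is small.  The two path edges at w_i then sum to L + 1 + i.  The legs, that is
   the edges at R, get the labels in (k, L].  Hence:
   - the sums at leaves are distinct labels <= L + 1;
   - the sums at spine vertices without legs are distinct values in
     (L + 1, L + 1 + s];
   - thanks to the tail, a leg can only be attached to w_i when
     i >= (s - 1)./2, so its label > k pushes the sum at w_i beyond L + 1 + s.
   Finally the legs are labelled so that sums at vertices with legs are distinct:
   reserve one leg at each such vertex, label the other legs arbitrarily, and
   give increasing labels to the reserved legs in the order of partial sums. *)

Set Implicit Arguments.
Unset Strict Implicit.
Unset Printing Implicit Defensive.

(** * Edges, degrees and edge labels carried by a rooted tree *)

Lemma set2_injr (T : finType) (v : T) : injective (fun y => [set v; y]).
Proof.
move=> y z /setP eq_yz.
have := eq_yz y; have := eq_yz z; rewrite !in_set2 !eqxx !orbT.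
by case: (eqVneq z v) => [->|_] /=; case: (eqVneq y v) => [->|_] //= /eqP.
Qed.

Lemma set2_eq (T : finType) (x y u v : T) :
  [set x; y] = [set u; v] -> x = u /\ y = v \/ x = v /\ y = u.
Proof.
move=> E.
have : x \in [set u; v] by rewrite -E set21.
rewrite in_set2 => /orP[] /eqP xE; [left | right]; split=> //.
  by apply: (@set2_injr _ x); rewrite E xE.
by apply: (@set2_injr _ x); rewrite E xE setUC.
Qed.

Lemma edgesP (T : finType) (e : rel T) (E : {set T}) :
  reflect (exists x y, e x y /\ E = [set x; y]) (E \in edges e).
Proof.
apply: (iffP imsetP) => [[[x y] exy ->]|[x [y [exy ->]]]].
  by exists x, y; split=> //; rewrite inE in exy.
by exists (x, y); rewrite // inE.
Qed.

Lemma deg_neighbors (T : finType) (e : rel T) (v : T) :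
  simple_graph e -> deg e v = #|[set y | e v y]|.
Proof.
case=> sym_e irr_e; rewrite /deg -(card_imset _ (@set2_injr T v)).
apply: eq_card => E; rewrite !inE; apply/andP/imsetP.
  case=> /edgesP[x [y [exy ->]]]; rewrite in_set2 => /orP[] /eqP ->.
    by exists y; rewrite ?inE.
  by exists x; rewrite ?inE 1?sym_e 1?setUC.
case=> y; rewrite inE => evy ->; split; last by rewrite set21.
by apply/edgesP; exists v, y.
Qed.

(* The graph is a tree rooted at b with parent map par, and g x is the label of
   the edge from x to its parent, so that edge labels become vertex labels. *)
Lemma antimagic_rooted (T : finType) (e : rel T) (b : T) (par : T -> T)
    (g : T -> nat) :
  {in predC1 b, forall x, e x (par x)} ->
  (forall x y, e x y -> x != b /\ y = par x \/ y != b /\ x = par y) ->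
  {in predC1 b, forall x, par x != b -> par (par x) != x} ->
  {in predC1 b &, injective g} ->
  {in predC1 b, forall x, 1 <= g x <= #|T|.-1} ->
  injective (fun v => \sum_(x | (x != b) && ((x == v) || (par x == v))) g x) ->
  antimagic e.
Proof.
move=> e_par parP par2 inj_g le_g inj_S.
pose ed x := [set x; par x].
(* Two non-root vertices could share an edge only as parents of each other, which the third
   hypothesis excludes. *)
have inj_ed : {in predC1 b &, injective ed}.
  move=> x y xb yb /set2_eq[[]//|[xE yE]].
  by have := par2 x xb; rewrite yE xE eqxx => /(_ yb).
have edgesE E : reflect (exists2 x, x != b & E = ed x) (E \in edges e).
  apply: (iffP (edgesP _ _)) => [[x [y [exy ->]]]|[x xb ->]].
    case: (parP _ _ exy) => [[xb ->]|[yb ->]]; first by exists x.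
    by exists y; rewrite // setUC.
  by exists x, (par x); split=> //; apply: e_par.
(* The default 0 is harmless: [f] is only ever evaluated on edges. *)
pose f E := if [pick x | (x != b) && (E == ed x)] is Some x then g x else 0.
have fE x : x != b -> f (ed x) = g x.
  move=> xb; rewrite /f; case: pickP => [y /andP[yb /eqP/inj_ed->]//|].
  by move/(_ x); rewrite xb eqxx.
have edges_imset : edges e = [set ed x | x in predC1 b].
  apply/setP=> E; apply/edgesE/imsetP => -[x]; first by exists x.
  by move=> xb ->; exists x.
have card_edges : #|edges e| = #|T|.-1.
  by rewrite edges_imset card_in_imset // cardC1.
exists f; split.
- move=> _ _ /edgesE[x xb ->] /edgesE[y yb ->]; rewrite !fE // => /inj_g.
  by move=> /(_ xb yb) ->.
(* Surjectivity by counting: the labels are distinct, lie in the range, and are as many as the range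
   has elements. *)
- pose l := [seq g x | x <- enum (predC1 b)].
  have : l =i iota 1 #|edges e|.
    apply: (uniq_min_size _ _ _).2.
    + rewrite map_inj_in_uniq ?enum_uniq // => x y.
      by rewrite !mem_enum; apply: inj_g.
    + move=> k /mapP[x]; rewrite mem_enum => xb ->.
      by rewrite mem_iota card_edges add1n ltnS; apply: le_g.
    + rewrite size_iota size_map -cardE edges_imset card_in_imset //.
  move=> lE k; move: (lE k); rewrite mem_iota add1n ltnS => <-.
  split=> [[_ /edgesE[x xb ->] <-]|/mapP[x]].
    by rewrite fE // map_f // mem_enum.
  rewrite mem_enum => xb ->; exists (ed x); rewrite ?fE //.
  by apply/edgesE; exists x.
- apply: eq_inj inj_S _ => v; symmetry.
  rewrite (eq_bigl (mem [set ed x | x in [pred x | (x != b) && ((x == v) || (par x == v))]])).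
    rewrite big_imset /=.
      by apply: eq_big => x //; rewrite inE => /andP[xb _]; rewrite fE.
    by move=> x y; rewrite !inE => /andP[xb _] /andP[yb _]; apply: inj_ed.
  move=> E; rewrite /= inE; apply/andP/imsetP.
    case=> /edgesE[x xb ->] vx; exists x => //; rewrite inE xb.
    by move: vx; rewrite in_set2 !(eq_sym v).
  case=> x; rewrite !inE => /andP[xb vx] ->; split; first by apply/edgesE; exists x.
  by rewrite in_set2 !(eq_sym v).
Qed.

(** * Labels for the legs and for the long path *)

(** Here [c] is the part of the sum fixed in advance. The reserved labels strictly increase along
    weakly increasing partial sums [P], so ties in [P] do no harm. *)
Lemma leg_labels (T : finType) (R : {set T}) (h : T -> T) (c : T -> nat) (k : nat) :
  exists g : T -> nat,
    [/\ {in R &, injective g}, {in R, forall x, k < g x <= k + #|R|} &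
        {in R &, forall x y,
           c (h x) + \sum_(z in R | h z == h x) g z =
           c (h y) + \sum_(z in R | h z == h y) g z -> h x = h y}].
Proof.
pose rep u := [pick z in R | h z == u].
pose isrep x := rep (h x) == Some x.
pose s1 := [seq x <- enum R | ~~ isrep x].
pose s2 := [seq x <- enum R | isrep x].
(* Since [s1] comes first in [s], [g1] is already the final label of an unreserved leg; so [P] can
   be computed before the reserved legs are sorted by it. *)
pose g1 x := k.+1 + index x s1.
pose P x := c (h x) + \sum_(z in R | (h z == h x) && ~~ isrep z) g1 z.
pose le x y := P x <= P y.
pose s := s1 ++ sort le s2.
have s_perm : perm_eq s (enum R).
  rewrite perm_catC; apply: perm_trans (permEl (perm_filterC isrep _)).
  by rewrite perm_cat2r perm_sort.
have mem_s x : (x \in s) = (x \in R) by rewrite (perm_mem s_perm) mem_enum.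
have size_s : size s = #|R| by rewrite (perm_size s_perm) -cardE.
pose g x := k.+1 + index x s.
have mem_s2 x : (x \in sort le s2) = (x \in R) && isrep x.
  by rewrite mem_sort mem_filter mem_enum andbC.
have mem_s1 x : (x \in s1) = (x \in R) && ~~ isrep x.
  by rewrite mem_filter mem_enum andbC.
have g_s1 x : x \in R -> ~~ isrep x -> g x = g1 x.
  by move=> xR xr; rewrite /g /g1 /s index_cat mem_s1 xR xr.
have inj_g : {in R &, injective g}.
  by move=> x y xR yR /addnI /index_inj -> //; rewrite mem_s.
have repP x : x \in R -> exists z, [/\ z \in R, isrep z & h z = h x].
  move=> xR; case E: (rep (h x)) => [z|].
    have := E; rewrite /rep; case: pickP => // z' /andP[zR /eqP zx] [zz].
    rewrite zz in zR zx.
    by exists z; split=> //; rewrite /isrep zx E.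
  by move: E; rewrite /rep; case: pickP => // /(_ x); rewrite xR eqxx.
have sumE z : z \in R -> isrep z ->
    c (h z) + \sum_(y in R | h y == h z) g y = P z + g z.
  move=> zR zr; rewrite (bigD1 z) /= ?zR ?eqxx // (addnC (g z)) addnA.
  congr (_ + _ + _); apply: eq_big => [y|y].
    rewrite -!andbA; case yR: (y \in R) => //=.
    case: (eqVneq (h y) (h z)) => //= hyz; congr (~~ _).
    by move: zr; rewrite /isrep hyz => /eqP ->; apply/eqP/eqP => [->|[]].
  case/andP=> /andP[yR /eqP hyz] yz; apply: g_s1 => //.
  by move: zr yz; rewrite /isrep hyz => /eqP ->; apply: contraNN => /eqP[->].
have mono x y : x \in R -> isrep x -> y \in R -> isrep y -> g x < g y ->
    P x <= P y.
  move=> xR xr yR yr; rewrite ltn_add2l /s !index_cat !mem_s1 xR xr yR yr /=.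
  rewrite ltn_add2l => lt_xy.
  have le_tr : transitive le by move=> ? ? ?; apply: leq_trans.
  have le_s : sorted le (sort le s2) by apply: sort_sorted => ? ?; apply: leq_total.
  by apply: (sorted_ltn_index le_tr le_s); rewrite ?mem_s2 ?xR ?yR.
exists g; split=> // [x xR|x y xR yR].
  rewrite /g addSn !ltnS leq_addr /= -addnS leq_add2l -size_s index_mem mem_s //.
case: (repP _ xR) => x' [x'R x'r <-]; case: (repP _ yR) => y' [y'R y'r <-].
rewrite !sumE //; case: (ltngtP (g x') (g y')) => [lt|gt|/inj_g -> //].
  by have := mono _ _ x'R x'r y'R y'r lt; lia.
by have := mono _ _ y'R y'r x'R x'r gt; lia.
Qed.

(* The label of w_i w_{i+1}: small when i + s is even, large otherwise. *)
Definition zigzag (s L i : nat) : nat := i./2.+1 + odd (i + s) * L.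

Lemma zigzagS s L i : zigzag s L i + zigzag s L i.+1 = L + i.+2.
Proof. by rewrite /zigzag addSn /=; case: odd; lia. Qed.

Lemma zigzag_last s L : zigzag s L s = s./2.+1.
Proof. by rewrite /zigzag addnn odd_double mul0n addn0. Qed.

(** Distinct indices of equal parity have distinct halves, and [s./2 < L] keeps the small labels
    below the large ones. *)
Lemma zigzag_inj s L i j : s./2 < L -> i <= s -> j <= s ->
  zigzag s L i = zigzag s L j -> i = j.
Proof.
by rewrite /zigzag; case: (boolP (odd (i + s))); case: (boolP (odd (j + s))) => /=; lia.
Qed.

Lemma zigzag_range s L i : s./2 < L -> i <= s ->
  (1 <= zigzag s L i <= s./2.+1) || (L < zigzag s L i <= L + uphalf s).
Proof. by rewrite /zigzag; case: (boolP (odd (i + s))) => /=; lia. Qed.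

(* q lists the spine in path order, and h maps a leaf to its only neighbor. *)
Definition spine_layout (T : finType) (e : rel T) (q : seq T) (h : T -> T) :=
  [/\ q != [::], uniq q,
      {in q &, forall x y,
         e x y = (index y q == (index x q).+1) || (index x q == (index y q).+1)},
      forall x y, x \notin q -> e x y = (y == h x) &
      forall x, x \notin q -> h x \in q].

(** * The labelling of the caterpillar and its vertex sums *)

(** The tail enters only through the last hypothesis. Its successor reflects that position [i] in
    [q] is position [i.+1] in the path [w], which starts with the leaf [a]. *)
Lemma antimagic_layout (T : finType) (e : rel T) (q : seq T) (h : T -> T) (a b : T) :
  simple_graph e -> spine_layout e q h ->
  a \notin q -> b \notin q -> a != b -> h a = head b q -> h b = last b q ->
  (forall x, x \notin q -> x != a -> x != b -> (size q).-1./2 <= (index (h x) q).+1) ->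
  antimagic e.
Proof.
move=> [sym_e irr_e] [q0 uq qq eh hq] aq bq ab ha hb tail.
pose w := a :: rcons q b; pose s := size q.
have s_gt0 : 0 < s by rewrite lt0n size_eq0.
have size_w : size w = s.+2 by rewrite /= size_rcons.
have uw : uniq w.
  by rewrite /= mem_rcons in_cons negb_or ab aq rcons_uniq bq.
pose id x := index x w.
have mem_w x : (x \in w) = (id x < s.+2) by rewrite -size_w index_mem.
pose W i := nth b w i.
have idW i : i < s.+2 -> id (W i) = i by rewrite -size_w => ?; apply: index_uniq.
have Wid x : x \in w -> W (id x) = x by apply: nth_index.
have W0 : W 0 = a by [].
have Wl : W s.+1 = b by rewrite /W /= nth_rcons ltnn eqxx.
have wE x : (x \in w) = [|| x == a, x == b | x \in q].
  by rewrite in_cons mem_rcons in_cons.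
have qW x : x \in q -> id x = (index x q).+1.
  move=> xq; rewrite /id /= -cats1 index_cat xq.
  by case: eqP => // ax; rewrite ax xq in aq.
have mem_qw x : x \in q -> x \in w by rewrite wE => ->; rewrite !orbT.
have id_b x : x \in w -> x != b -> id x <= s.
  move=> xw xb; move: (xw); rewrite mem_w !ltnS leq_eqVlt => /orP[/eqP E|//].
  by move: xb; rewrite -(Wid x xw) E Wl eqxx.
have Wq i : 0 < i <= s -> W i \in q.
  case: i => // i lt_is; rewrite /W /= nth_rcons.
  by rewrite -/s; move: lt_is => /= lt_is; rewrite lt_is mem_nth.
(* Rooted at [b], each path vertex has its successor as parent, so the edge from [W i] to [W i.+1]
   is labelled at [W i]. *)
pose par x := if x \in w then W (id x).+1 else h x.
pose R := [set x | x \notin w].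
pose k := s./2.+1; pose L := k + #|R|.
(* The ranges [[1, k]], [(k, L]] and [(L, L + uphalf s]] thus use up all labels. *)
have card_T : #|T|.-1 = L + uphalf s.
  have -> : #|T| = #|R| + s.+2.
    rewrite -size_w -(card_uniqP uw) addnC -(cardC (mem w)).
    by congr (_ + _); apply: eq_card => x; rewrite !inE.
  by rewrite /L /k; lia.
have R_q x : x \in R -> x \notin q.
  by rewrite inE; apply: contra => /mem_qw.
(* The fixed part is the sum of the two path edges at [u], by [zigzagS]. *)
have [g0 [inj_g0 g0_range g0_sum]] := leg_labels R h (fun u => L + (id u).+1) k.
have ltsL : s./2 < L by rewrite /L /k; lia.
pose g x := if x \in w then zigzag s L (id x) else g0 x.
have g0R x : x \notin w -> k < g0 x <= L by move=> xw; apply: g0_range; rewrite inE.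
have parW x i : x \in w -> x != b -> i <= s.+1 -> (par x == W i) = ((id x).+1 == i).
  move=> xw xb le_i; rewrite /par xw nth_uniq ?size_w //.
  by rewrite !ltnS id_b.
have par_leg x : x \notin w -> par x = h x by rewrite /par => /negPf ->.
have leg_q x : x \notin w -> h x \in q by move=> xw; apply/hq/R_q; rewrite inE.
have neq_b x : x \notin w -> x != b by apply: contraNneq => ->; rewrite wE eqxx orbT.
pose S v := \sum_(x | (x != b) && ((x == v) || (par x == v))) g x.
have S_leg v : v \notin w -> S v = g0 v.
  move=> vw; rewrite /S (big_pred1 v) => [|x /=]; first by rewrite /g (negPf vw).
  case: (eqVneq x v) => [->|_]; first by rewrite neq_b.
  case xb: (x != b) => //=; apply: contraNF vw => /eqP <-; rewrite /par.
  case: ifP => xw; last by apply/mem_qw/leg_q; rewrite xw.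
  by rewrite mem_w idW // !ltnS id_b.
have S_a : S a = zigzag s L 0.
  rewrite /S (big_pred1 a) => [|x /=].
    by rewrite /g wE eqxx /id /= eqxx.
  case: (eqVneq x a) => [->|_]; first by rewrite ab.
  case xb: (x != b) => //=; case xw: (x \in w); first by rewrite -W0 parW.
  by rewrite par_leg ?xw //; apply: contraNF aq => /eqP <-; apply: leg_q; rewrite xw.
have S_b : S b = k.
  have ws : W s \in w by apply/mem_qw/Wq; rewrite s_gt0 /=.
  rewrite /S (big_pred1 (W s)) => [|x /=].
    by rewrite /g ws idW // zigzag_last.
  case: (eqVneq x b) => [->|xb] /=.
    by symmetry; apply: contraNF bq => /eqP ->; apply: Wq; rewrite s_gt0 /=.
  case xw: (x \in w).
    by rewrite -Wl parW // eqSS; apply/eqP/eqP => [<-|->]; rewrite ?Wid ?idW.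
  rewrite par_leg ?xw //.
  have -> : (h x == b) = false by apply: contraNF bq => /eqP <-; apply: leg_q; rewrite xw.
  by symmetry; apply: contraFF xw => /eqP ->.
have S_q v : v \in q -> S v = L + (id v).+1 + \sum_(z in R | h z == v) g0 z.
  (* By the shift between [q] and [w], [u] is the predecessor of [v] on the path. *)
  move=> vq; have vw := mem_qw v vq; pose u := W (index v q).
  have lt_i : index v q < s by rewrite index_mem.
  have uw' : u \in w by rewrite mem_w idW //; clear -lt_i; lia.
  have vb : v != b by apply: contraNneq bq => <-.
  have ub : u != b by rewrite -Wl nth_uniq ?size_w //; clear -lt_i; lia.
  have uv : u != v by rewrite -(Wid v vw) (qW v vq) nth_uniq ?size_w //; clear -lt_i; lia.
  have idu : id u = index v q by rewrite idW //; clear -lt_i; lia.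
  have pu : par u == v by rewrite -(Wid v vw) parW // (qW v vq) ?idu //; clear -lt_i; lia.
  rewrite /S (bigD1 v) /= ?vb ?eqxx // (bigD1 u) /=; last by rewrite ub pu uv orbT.
  rewrite addnA; congr (_ + _).
    rewrite /g vw uw' idu (qW v vq) addnC zigzagS //.
  rewrite (eq_bigl (fun z => (z \in R) && (h z == v))) => [|x].
    by apply: eq_bigr => x /andP[]; rewrite inE /g => /negPf ->.
  rewrite inE; case xw: (x \in w) => /=; last first.
      rewrite par_leg ?xw // neq_b ?xw //=.
      have -> : x != v by apply: contraFneq xw => ->.
      have -> : x != u by apply: contraFneq xw => ->.
      by rewrite !andbT; case: eqP => // xv; rewrite xv vw in xw.
    case: (eqVneq x b) => //= xb; case: (eqVneq x v) => //= xv.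
    rewrite -(Wid v vw) parW // (qW v vq); last by clear -lt_i; lia.
    rewrite eqSS /= andbT; apply/negP => /andP[/eqP E /negP[]].
    by apply/eqP; rewrite -(Wid x xw) E.
(* The path edges give at least [L + (s.-1)./2 + 1] and the leg at least [s./2 + 2], in total at
   least [L + s + 2]. *)
have legs_gt x v : x \in R -> h x = v -> L + s.+1 < S v.
  move=> xR hx; have xq := R_q x xR; have vq : v \in q by rewrite -hx hq.
  have := xR; rewrite inE wE !negb_or => /and3P[xa xb _].
  have := tail x xq xa xb; rewrite hx -/s S_q // (bigD1 x) /=; last by rewrite xR hx eqxx.
  by have := g0_range x xR; rewrite (qW v vq) /k; clear; lia.
have no_legs v : v \in q -> [pred x in R | h x == v] =1 pred0 -> S v = L + (id v).+1.
  by move=> vq none; rewrite S_q // big_pred0 // addn0.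
have S_q_gt v : v \in q -> L.+1 < S v.
  by move=> vq; rewrite S_q // qW //; clear; lia.
have S_leaf v : v \notin q -> S v <= L.+1.
  move=> vq; case: (boolP (v \in w)) => [|vw]; last first.
    by rewrite S_leg //; have := g0R v vw; clear; lia.
  rewrite wE (negPf vq) orbF => /orP[]/eqP ->; rewrite ?S_a ?S_b; last first.
    by rewrite /L; clear; lia.
  by rewrite /zigzag; case: odd; clear; lia.
(* The parity of [s] decides whether the first path edge is small or large. Either way [S a] avoids
   both [S b = k] and the leg labels in [(k, L]]. *)
have S_a_range : (S a = 1 /\ 1 < k) \/ S a = L.+1.
  by rewrite S_a /zigzag /k add0n; move: s_gt0; clear; case: (boolP (odd s)) => /=; lia.
apply: (@antimagic_rooted _ _ b par g).
- move=> x xb; rewrite inE in xb; rewrite /par; case: ifP => xw; last first.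
    by rewrite eh ?eqxx //; apply: R_q; rewrite inE xw.
  have := xw; rewrite wE (negPf xb) => /orP[/eqP -> | xq].
    rewrite eh // ha; apply/eqP; rewrite /id /= eqxx /W /= nth_rcons.
    by rewrite -/s s_gt0 nth0.
  case: (ltngtP (index x q) s.-1) => [lt|gt_s|E].
  + have lt2 : (id x).+1 <= s by rewrite qW //; clear -lt; lia.
    have idq := idW (id x).+1; have Wqx : W (id x).+1 \in q by rewrite Wq.
    rewrite qq //; move: idq; rewrite ltnS (leqW lt2) => /(_ isT).
    by rewrite (qW _ Wqx) => -[->]; rewrite (qW x xq) eqxx.
  + have : index x q < s by rewrite index_mem.
    by rewrite -(prednK s_gt0) ltnS leqNgt gt_s.
  + by rewrite qW // E prednK // Wl sym_e eh // hb -nth_last -/s -E nth_index.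
- move=> x y exy.
  have leafs u v : u \notin q -> e u v -> u != b /\ v = par u \/ v != b /\ u = par v.
    move=> uNq; rewrite (eh u) // => /eqP ->.
    case: (eqVneq u b) => [ub|ub]; [right | left; split=> //].
      have lq : last b q \in q by case: (q) q0 => // y0 q1 _; exact: (mem_last y0 q1).
      rewrite ub hb.
      split; first by apply: contraNneq bq => <-.
      by rewrite /par mem_qw // qW // -nth_last index_uniq ?ltn_predL // prednK.
    case: (eqVneq u a) => [->|ua].
      rewrite ha /par wE eqxx /= /id /= eqxx /W /= nth_rcons.
      by rewrite -/s s_gt0 nth0.
    by rewrite par_leg // wE (negPf ua) (negPf ub).
  case: (boolP (x \in q)) => xq; last exact: leafs.
  case: (boolP (y \in q)) => yq; last first.
    by rewrite sym_e in exy; case: (leafs y x yq exy); [right | left].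
  have xb : x != b by apply: contraNneq bq => <-.
  have yb : y != b by apply: contraNneq bq => <-.
  move: exy; rewrite qq // => /orP[]/eqP E; [left | right]; split=> //.
    by rewrite /par mem_qw // qW // -E -qW // Wid // mem_qw.
  by rewrite /par mem_qw // qW // -E -qW // Wid // mem_qw.
- move=> x xb pb; rewrite inE in xb; case: (boolP (x \in w)) => xw.
    have lt := id_b x xw xb; rewrite -[X in _ != X](Wid x xw) parW //; first last.
    + by clear -lt; lia.
    + by rewrite /par xw mem_w idW; clear -lt; lia.
    by rewrite /par xw idW; clear -lt; lia.
  have pw : par x \in w by rewrite par_leg //; apply/mem_qw/leg_q.
  apply: contraNneq xw => <-; rewrite /par -/(par x) pw.
  by rewrite mem_w idW !ltnS id_b.
- move=> x y; rewrite !inE => xb yb; rewrite /g.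
  case: (boolP (x \in w)) => xw; case: (boolP (y \in w)) => yw.
  + move/zigzag_inj => E; rewrite -(Wid x xw) -(Wid y yw); congr W.
    by apply: E => //; apply: id_b.
  + by have := zigzag_range ltsL (id_b x xw xb); have := g0R y yw; rewrite /k; clear; lia.
  + by have := zigzag_range ltsL (id_b y yw yb); have := g0R x xw; rewrite /k; clear; lia.
  + by apply: inj_g0; rewrite inE.
- move=> x; rewrite inE => xb; rewrite card_T /g; case: (boolP (x \in w)) => xw.
    by have := zigzag_range ltsL (id_b x xw xb); rewrite -/k /L; clear; lia.
  by have := g0R x xw; clear; lia.
- move=> u v; rewrite -/(S u) -/(S v) => E.
  case: (boolP (u \in q)) => uQ; case: (boolP (v \in q)) => vQ.
  + case: (pickP [pred x in R | h x == u]) => [x /andP[xR /eqP xu]|u0];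
    case: (pickP [pred x in R | h x == v]) => [y /andP[yR /eqP yv]|v0].
    * by rewrite -xu -yv; apply: g0_sum => //; rewrite xu yv -!S_q.
    * have := legs_gt x u xR xu; rewrite E no_legs // (qW v vQ).
      by have : index v q < s by [rewrite index_mem]; clear; lia.
    * have := legs_gt y v yR yv; rewrite -E no_legs // (qW u uQ).
      by have : index u q < s by [rewrite index_mem]; clear; lia.
    * move: E; rewrite !no_legs // => E; rewrite -(Wid u) ?mem_qw // -(Wid v) ?mem_qw //.
      by congr W; clear -E; lia.
  + by have := S_q_gt u uQ; have := S_leaf v vQ; rewrite E; clear; lia.
  + by have := S_q_gt v vQ; have := S_leaf u uQ; rewrite E; clear; lia.
  + case: (boolP (u \in w)) => uw'; case: (boolP (v \in w)) => vw'.
    * have := uw'; have := vw'; rewrite !wE (negPf uQ) (negPf vQ) !orbF.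
      move=> /orP[]/eqP Ev /orP[]/eqP Eu; rewrite Eu Ev // in E *;
      by move: S_a_range; rewrite ?E ?S_b -?E ?S_b /L; clear; lia.
    * have := uw'; rewrite wE (negPf uQ) orbF; have := g0R v vw'; rewrite -S_leg // -E.
      by move=> bnd /orP[]/eqP Eu; move: bnd S_a_range; rewrite Eu ?S_b; clear; lia.
    * have := vw'; rewrite wE (negPf vQ) orbF; have := g0R u uw'; rewrite -S_leg // E.
      by move=> bnd /orP[]/eqP Ev; move: bnd S_a_range; rewrite Ev ?S_b; clear; lia.
    * by move: E; rewrite !S_leg // => /inj_g0; apply; rewrite inE.
Qed.

(** * From a caterpillar to an ordered spine with end leaves *)

Lemma deg_gt2 (T : finType) (e : rel T) (v x y z : T) :
  simple_graph e -> uniq [:: x; y; z] -> e v x -> e v y -> e v z -> 2 < deg e v.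
Proof.
move=> sim uxyz ex ey ez; rewrite deg_neighbors //.
apply: leq_trans (_ : #|[:: x; y; z]| <= _); first by rewrite (card_uniqP uxyz).
apply/subset_leq_card/subsetP => u; rewrite !inE.
by case/or3P=> /eqP ->.
Qed.

(** Off the spine degrees are 1, so [h] picks the only neighbor. Were that neighbor a leaf too, the
    two would form a whole component, against connectedness and order at least 3. *)
Lemma caterpillar_layout (T : finType) (e : rel T) :
  caterpillar e -> exists q h, spine_layout e q h /\ q =i spine e.
Proof.
case=> [[sim [_ conn] _] T3 [q [q0 uq qE qq]]]; case: (sim) => sym_e irr_e.
pose h x := odflt x [pick y | e x y].
have eh x y : x \notin q -> e x y = (y == h x).
  rewrite qE inE negbK deg_neighbors // => /cards1P[z /setP eq_z].
  have ez u : e x u = (u == z) by have := eq_z u; rewrite !inE.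
  rewrite /h; case: pickP => [u|none]; first by rewrite !ez => /eqP ->.
  by have := none z; rewrite ez eqxx.
exists q, h; split=> //; split=> // x xq; apply: contraLR T3 => hxq.
have hhx z : e (h x) z = (z == x).
  have : e (h x) x by rewrite sym_e eh.
  by rewrite !eh // => /eqP <-.
have clos : closed e [set x; h x].
  apply: intro_closed; first exact: sym_connect_sym.
  move=> y z eyz; rewrite !inE => /orP[]/eqP yE; move: eyz; rewrite yE.
    by rewrite eh // => ->; rewrite orbT.
  by rewrite hhx => ->.
have : #|T| <= #|[set x; h x]|.
  apply/subset_leq_card/subsetP => z _.
  by rewrite -(closed_connect clos (conn x z)) set21.
by rewrite cards2; case: (_ != _); rewrite -ltnNge => /leq_trans; apply.
Qed.

Lemma index_rev (T : eqType) (x : T) s :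
  uniq s -> x \in s -> index x (rev s) = size s - (index x s).+1.
Proof.
move=> us xs; have lt : index x s < size s by rewrite index_mem.
have E : size s - (size s - (index x s).+1).+1 = index x s by lia.
rewrite -{1}(nth_index x xs) -{1}E.
by rewrite -nth_rev ?index_uniq ?rev_uniq ?size_rev //; lia.
Qed.

Lemma spine_layout_rev (T : finType) (e : rel T) q h :
  spine_layout e q h -> spine_layout e (rev q) h.
Proof.
case=> q0 uq qq eh hq; split; rewrite ?rev_uniq //.
- by rewrite -size_eq0 size_rev size_eq0.
- move=> x y; rewrite !mem_rev => xq yq; rewrite qq // !index_rev //.
  move: (xq) (yq); rewrite -!index_mem; move: (index x q) (index y q) => i j.
  by move=> ? ?; apply/orP/orP => -[]/eqP E; [right | left | right | left]; apply/eqP; lia.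
- by move=> x y; rewrite mem_rev; apply: eh.
- by move=> x; rewrite !mem_rev; apply: hq.
Qed.

(** With no leaf attached, the first spine vertex would have the second one as its only neighbor and
    so be a leaf itself. *)
Lemma head_leaf (T : finType) (e : rel T) q h x0 :
  simple_graph e -> spine_layout e q h -> q =i spine e -> 1 < size q ->
  exists2 a, a \notin q & h a = head x0 q.
Proof.
move=> sim [q0 uq qq eh hq] qE q_gt1; case: (sim) => sym_e _.
have hd : head x0 q \in q by case: (q) q0 => //= *; rewrite mem_head.
have := hd; rewrite qE inE => deg1.
case: (pickP [pred a | (a \notin q) && (h a == head x0 q)]) => [a /andP[aq /eqP]|none].
  by exists a.
case/negP: deg1; rewrite deg_neighbors //; apply/cards1P.
exists (nth x0 q 1); apply/setP => y; rewrite !inE.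
have i0 : index (head x0 q) q = 0 by rewrite -nth0 index_uniq // ltnW.
case: (boolP (y \in q)) => yq.
  by rewrite qq // i0 /= orbF -[in RHS](nth_index x0 yq) nth_uniq ?index_mem.
rewrite sym_e eh // eq_sym; have /= := none y; rewrite yq /= => ->.
by symmetry; apply: contraNF yq => /eqP ->; apply: mem_nth.
Qed.

(** On a longer spine the leaves differ because they hang at different ends; a one-vertex spine
    carries all the other vertices, at least two, as leaves. *)
Lemma end_leaves (T : finType) (e : rel T) q h :
  simple_graph e -> spine_layout e q h -> q =i spine e -> 2 < #|T| ->
  exists a b, [/\ a \notin q, b \notin q, a != b, h a = head b q & h b = last b q].
Proof.
move=> sim lay qE T3; case: (lay) => q0 uq _ _ hq.
case: q q0 uq lay qE hq => [//|x0 [|x1 q]] _ uq lay qE hq; last first.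
  have [a aq ha] := head_leaf x0 sim lay qE isT.
  have qE' : rev [:: x0, x1 & q] =i spine e by move=> x; rewrite mem_rev qE.
  have [|b bq hb] := head_leaf x0 sim (spine_layout_rev lay) qE'.
    by rewrite size_rev.
  rewrite mem_rev in bq; have {}hb : h b = last b [:: x0, x1 & q].
    by rewrite hb -nth0 nth_rev // subn1 nth_last.
  exists a, b; split=> //; apply: contraTneq uq => ab.
  have : x0 = last x1 q by move: ha hb; rewrite ab => -> /=.
  by move=> ->; rewrite /= mem_last.
have : 1 < #|[set~ x0]| by rewrite cardsC1; lia.
case/card_gt1P => a [b [aq bq ab]]; rewrite !inE in aq bq.
exists a, b; split; rewrite ?inE //=.
  by have := hq a; rewrite !inE => /(_ aq)/eqP.
by have := hq b; rewrite !inE => /(_ bq)/eqP.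
Qed.

Lemma spine_gpath (T : finType) (e : rel T) q h a b :
  simple_graph e -> spine_layout e q h -> a \notin q -> b \notin q -> a != b ->
  h a = head b q -> h b = last b q -> gpath e (a :: rcons q b).
Proof.
move=> [sym_e _] [q0 uq qq eh hq] aq bq ab ha hb.
rewrite /gpath /= mem_rcons in_cons negb_or ab aq rcons_uniq bq uq /= andbT.
rewrite rcons_path; have -> : e (last a q) b.
  by rewrite sym_e eh // hb; case: (q) q0.
have sq : sorted e q.
  apply/(sortedP b) => i lt; have lt' := ltnW lt.
  by rewrite qq ?mem_nth // !index_uniq // eqxx.
by case: (q) q0 sq ha => //= x s _ -> ha; rewrite eh // ha eqxx.
Qed.

Lemma gpath_rev (T : finType) (e : rel T) p :
  symmetric e -> gpath e (rev p) = gpath e p.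
Proof.
move=> sym_e; rewrite /gpath rev_uniq rev_sorted; congr (_ && _).
by apply: eq_sorted => x y; rewrite sym_e.
Qed.

(** * Longest paths and tails *)

(** An inner vertex of a path has two distinct neighbors, a leaf only one. *)
Lemma off_spine_end (T : finType) (e : rel T) q h p1 y p2 :
  simple_graph e -> spine_layout e q h -> gpath e (p1 ++ y :: p2) ->
  y \notin q -> p1 = [::] \/ p2 = [::].
Proof.
move=> [sym_e _] [q0 uq qq eh hq] /andP[srt un] yq.
case/lastP: p1 srt un => [|p1 x]; [by left | case: p2 => [|z p2]; [by right|]].
rewrite cat_rcons => srt un; exfalso.
have [xy yz] : e x y /\ e y z.
  move: srt; case: (p1) => [|u p] /=; first by case/and3P.
  by rewrite cat_path /= => /and5P[].
have xz : x = z by move: xy yz; rewrite sym_e !eh // => /eqP -> /eqP ->.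
by move: un; rewrite cat_uniq xz /= !inE eqxx !orbT /= !andbF.
Qed.

(* A path with s + 2 vertices exists, and only the ends of a path lie off the
   spine; so a longest path starting in the spine would have at least s + 1
   vertices in it. *)
Lemma end_of_longest_path_leaf (T : finType) (e : rel T) q h v :
  simple_graph e -> spine_layout e q h -> q =i spine e -> 2 < #|T| ->
  end_of_longest_path e v -> v \notin q.
Proof.
move=> sim lay qE T3 [x [p [px p_max vE]]].
have [a [b [aq bq ab ha hb]]] := end_leaves sim lay qE T3.
have := p_max _ (spine_gpath sim lay aq bq ab ha hb); rewrite /= size_rcons => le_p.
have [r [rv size_r]] : exists r, gpath e (v :: r) /\ size q < size r.
  case: vE => ->; first by exists p.
  have sym_e := sim.1; exists (rev (belast x p)); rewrite -rev_rcons -lastI gpath_rev //.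
  by rewrite size_rev size_belast.
case/lastP: r rv size_r => [//|r z] rv; rewrite size_rcons ltnS => size_r.
apply/negP => vq; have : size (v :: r) <= size q; last by rewrite leqNgt ltnS size_r.
apply: uniq_leq_size => [|y].
  by case/andP: rv => _; rewrite -rcons_cons rcons_uniq => /andP[].
rewrite in_cons => /predU1P[-> //|yr]; apply: contraLR (yr) => yq.
case/splitPr: yr rv {size_r} => r1 r2.
by rewrite rcons_cat -cat_cons => /(off_spine_end sim lay)/(_ yq)[]//; case: (r2).
Qed.

(** Each step changes the spine index by one, and a step back would revisit the vertex before; so
    the walk can only advance. *)
Lemma spine_walk (T : finType) (e : rel T) q h x0 r :
  spine_layout e q h -> gpath e r -> {subset r <= q} -> head x0 r = head x0 q ->
  forall i, i < size r -> nth x0 r i = nth x0 q i.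
Proof.
move=> [q0 uq qq _ _] /andP[srt ur] rq hd.
have size_r := uniq_leq_size ur rq.
elim/ltn_ind => -[|i] IH lt_i; first by rewrite !nth0.
have lt_i' := ltnW lt_i; have nq := leq_trans lt_i' size_r.
have Yq : nth x0 r i.+1 \in q by apply/rq/mem_nth.
have := sortedP x0 srt i lt_i; rewrite IH // qq ?mem_nth // index_uniq //.
case/orP=> /eqP E; first by rewrite -(nth_index x0 Yq) E.
case: i => [//|i] in IH lt_i lt_i' nq Yq E *.
have lt_i2 := ltnW lt_i'.
have /negP[] : nth x0 r i.+2 != nth x0 r i by rewrite nth_uniq //; lia.
by case: E => E; rewrite -(nth_index x0 Yq) -E IH.
Qed.

(** The leaf [v] must be an end of [p], and the rest of [p] runs inside the spine. The neighbor of
    [v] in [p] has degree 2, so it ends the spine, which is reversed if necessary. *)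
Lemma tail_orientation (T : finType) (e : rel T) q h v :
  simple_graph e -> spine_layout e q h -> q =i spine e ->
  v \notin q ->
  forall p, gpath e p -> size p = (size q - 1) %/ 2 -> v \in p ->
  (forall u, u \in p -> u != v -> deg e u = 2) ->
  exists q', [/\ spine_layout e q' h, q' =i spine e, size q' = size q &
     forall i, i.+1 < size p -> deg e (nth v q' i) = 2].
Proof.
move=> sim lay qE vq p pp size_p vp deg2; case: (sim) => sym_e _.
have [[|u r] [pr size_r degr]] : exists r, [/\ gpath e (v :: r), size p = (size r).+1 &
    forall u, u \in r -> deg e u = 2].
  case/splitPr: vp pp deg2 {size_p} => p1 p2 pp deg2.
  have degu u : u \in p1 ++ p2 -> deg e u = 2.
    move=> up; apply: deg2; first by move: up; rewrite !mem_cat inE orbCA => ->; rewrite orbT.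
    case/andP: pp => _; rewrite uniq_catC /= -[p2 ++ p1]/(p2 ++ p1) => /andP[vn _].
    by apply: contraNneq vn => <-; rewrite mem_cat orbC -mem_cat.
  case: (off_spine_end sim lay pp vq) => p0; rewrite p0 ?cats0 /= in pp degu *.
    by exists p2.
  exists (rev p1); split=> [||u]; last by rewrite mem_rev; apply: degu.
    by rewrite -rev_rcons gpath_rev // -cats1.
  by rewrite size_cat size_rev addn1.
  by exists q; split=> // i; rewrite size_r.
have rq : {subset u :: r <= q} by move=> x xr; rewrite qE inE degr.
have uq : u \in q by rewrite rq ?mem_head.
have [pur evu] : gpath e (u :: r) /\ e v u.
  by case/andP: pr => /= /andP[-> srt] /andP[_ ur]; rewrite /gpath /= srt.
suff [q' [lay' qE' size_q' hd]] : exists q', [/\ spine_layout e q' h, q' =i spine e,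
    size q' = size q & head v q' = u].
  exists q'; split=> // i; rewrite size_r ltnS => lt_i.
  rewrite -(spine_walk lay' pur) ?degr ?mem_nth //.
  by move=> x /rq; rewrite qE -qE'.
have lt_u : index u q < size q by rewrite index_mem.
case: (posnP (index u q)) => [u0|u_gt0].
  by exists q; split=> //; rewrite -nth0 -u0 nth_index.
case: (eqVneq (index u q) (size q).-1) => [ul|ul].
  exists (rev q); split; rewrite ?size_rev //; first exact: spine_layout_rev.
    by move=> x; rewrite mem_rev qE.
  by rewrite -nth0 nth_rev ?subn1 -?ul ?nth_index // (leq_ltn_trans _ lt_u).
(* Otherwise [u] is inside the spine, and its two spine neighbors together with [v] give it degree
   at least 3. *)
case: (lay) => _ unq qq eh hq.
pose i := index u q; have [lt1 lt2] : i.-1 < size q /\ i.+1 < size q by clear -lt_u ul; lia.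
have := @deg_gt2 _ e u v (nth v q i.-1) (nth v q i.+1) sim.
rewrite degr ?mem_head // => F; suff : 2 < 2 by [].
apply: F.
- rewrite /= !inE negb_or nth_uniq //.
  have -> : i.-1 != i.+1 by clear; lia.
  by rewrite !andbT; apply/andP; split; apply: contraNneq vq => ->; apply: mem_nth.
- by rewrite sym_e.
- by rewrite qq ?mem_nth // index_uniq // prednK // eqxx orbT.
- by rewrite qq ?mem_nth // index_uniq // eqxx.
Qed.

Theorem theorem3 (T : finType) (e : rel T) (s : nat)
  (hC : caterpillar e) (hs : #|spine e| = s)
  (ht : has_tail e ((s - 1) %/ 2)) :
  antimagic e.
Proof.
have [q1 [h [lay1 q1E]]] := caterpillar_layout hC.
case: (hC) => [[sim _ _] T3 _]; case: (sim) => sym_e _.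
have size_q1 : size q1 = s.
  by case: lay1 => _ uq _ _ _; rewrite -(card_uniqP uq) -hs; apply: eq_card.
have [q [lay qE size_q degq]] : exists q, [/\ spine_layout e q h, q =i spine e,
    size q = s & forall i x, i.+1 < (s - 1) %/ 2 -> deg e (nth x q i) = 2].
  (* For a tail of order 0 the degree condition is vacuous and either orientation will do. *)
  case: ht => p [pp size_p]; case: posnP => [-> _|t_gt0 /(_ isT)[v vp [v_end deg2]]].
    by exists q1.
  have vq := end_of_longest_path_leaf sim lay1 q1E T3 v_end.
  have size_p1 : size p = (size q1 - 1) %/ 2 by rewrite size_q1.
  have [q [lay qE size_q degq]] := tail_orientation sim lay1 q1E vq pp size_p1 vp deg2.
  exists q; split; rewrite ?size_q // => i x lt_i.
  by rewrite (set_nth_default v) ?degq ?size_p // size_q size_q1; clear -lt_i; lia.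
have [a [b [aq bq ab ha hb]]] := end_leaves sim lay qE T3.
apply: (antimagic_layout sim lay aq bq ab ha hb) => x xq xa _.
case: (lay) => q0 uq qq eh hq.
(* A leg attached too early would hang at a tail vertex of degree 2, which already has two neighbors
   on the path from [a] to [b]. *)
rewrite size_q leqNgt; apply/negP => lt_i; have hxq := hq x xq.
pose i := index (h x) q; have lt_is : i.+1 < size q.
  by rewrite size_q; move: lt_i; rewrite -/i; clear; lia.
have : deg e (h x) = 2.
  by rewrite -(nth_index x hxq); apply: degq; rewrite divn2 subn1.
have lt1 : i.-1 < size q := leq_ltn_trans (leq_pred i) (ltnW lt_is).
(* The predecessor of [h x] on the extended path; at the head of the spine it is [a], and [x]
   differs from [a] by assumption. *)
pose y := if i == 0 then a else nth a q i.-1.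
have hy : e (h x) y.
  rewrite /y; case: (eqVneq i 0) => i0.
    by rewrite sym_e eh // ha -nth0 -i0 nth_index.
  by rewrite qq ?mem_nth // index_uniq // prednK ?lt0n // eqxx orbT.
have y1 : y != nth a q i.+1.
  rewrite /y; case: (i =P 0) => i0; last by rewrite nth_uniq //; clear; lia.
  by apply: contraNneq aq => ->; apply: mem_nth.
have xy : x != y.
  rewrite /y; case: (i =P 0) => i0; first by [].
  by apply: contraNneq xq => ->; apply: mem_nth.
have x1 : x != nth a q i.+1 by apply: contraNneq xq => ->; apply: mem_nth.
have := @deg_gt2 _ e (h x) x y (nth a q i.+1) sim.
rewrite /= !inE negb_or xy x1 y1 => /(_ isT) F deg_hx; suff : 2 < 2 by [].
rewrite -{2}deg_hx; apply: F => //; first by rewrite sym_e eh.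
by rewrite qq ?mem_nth // index_uniq // eqxx.
Qed.
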